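(* For every integer $d\ge 2$ there exists an integer $n_1=n_1(d)$ such that every $d$-regular graph $G$ on $n\ge n_1$ vertices satisfies $\operatorname{tvs}(G)=\lceil (n+d)/(d+1)\rceil$.
   Context: All graphs are finite and simple, and need not be connected. For a positive integer $k$, a total $k$-labeling of a graph $G$ is a mapping $\lambda:V(G)\cup E(G)\to\{1,\ldots,k\}$. The weight of a vertex $v$ under $\lambda$ is $\operatorname{wt}_\lambda(v)=\lambda(v)+\sum_{e\ni v}\lambda(e)$, the sum being over the edges $e$ of $G$ incident with $v$. The labeling $\lambda$ is vertex irregular if $\operatorname{wt}_\lambda(u)\ne\operatorname{wt}_\lambda(v)$ for any two distinct vertices $u,v\in V(G)$. The total vertex irregularity strength $\operatorname{tvs}(G)$ is the smallest positive integer $k$ for which $G$ has a vertex irregular total $k$-labeling. *)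

(* Defs.v *)
From HB Require Import structures.
From mathcomp Require Import all_boot all_order all_algebra.

Set Implicit Arguments.
Unset Strict Implicit.
Unset Printing Implicit Defensive.

Record sgraph := SGraph {
  vertex :> finType;
  adj : rel vertex;
  adj_sym : symmetric adj;
  adj_irrefl : irreflexive adj
}.

Section TotalLabelings.
Variable G : sgraph.

Definition edges : {set {set G}} :=
  [set e | [exists u : G, exists v : G, adj u v && (e == [set u; v])]].

Definition edge := {e : {set G} | e \in edges}.

Definition deg (v : G) : nat := #|[set u : G | adj v u]|.

Definition regular (d : nat) : Prop := forall v : G, deg v = d.

(* V(G) and E(G) are disjoint, so their union is the sum type [G + edge]. *)
Definition total_labeling (k : nat) (lam : G + edge -> nat) : bool :=
  [forall x, 1 <= lam x <= k].

Definition wt (lam : G + edge -> nat) (v : G) : nat :=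
  lam (inl v) + \sum_(e : edge | v \in val e) lam (inr e).

Definition vertex_irregular (lam : G + edge -> nat) : bool :=
  injectiveb (wt lam).

(* Labels are at most k, so quantifying over maps into 'I_k.+1 loses nothing
   and makes the predicate boolean; see [has_irregular_labelingP]. *)
Definition has_irregular_labeling (k : nat) : bool :=
  [exists lam : {ffun G + edge -> 'I_k.+1},
    total_labeling k (fun x => lam x) && vertex_irregular (fun x => lam x)].

Lemma eq_wt (lam mu : G + edge -> nat) : lam =1 mu -> wt lam =1 wt mu.
Proof. by move=> E v; rewrite /wt E; congr (_ + _); apply: eq_bigr. Qed.

Lemma has_irregular_labelingP (k : nat) :
  reflect (exists lam : G + edge -> nat,
             total_labeling k lam /\ vertex_irregular lam)
          (has_irregular_labeling k).
Proof.
apply: (iffP existsP) => [[lam /andP[tl ir]]|[lam [tl /injectiveP ir]]].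
  by exists (fun x => nat_of_ord (lam x)).
have E (x : G + edge) :
    nat_of_ord ([ffun x => inord (lam x) : 'I_k.+1] x) = lam x.
  by rewrite ffunE inordK // ltnS; case/andP: (forallP tl x).
exists [ffun x => inord (lam x)]; apply/andP; split.
  by apply/forallP=> x; rewrite E; apply: (forallP tl).
by apply/injectiveP => u v; rewrite !(eq_wt E); apply: ir.
Qed.

Lemma exists_irregular_labeling :
  exists k, (0 < k) && has_irregular_labeling k.
Proof.
pose inc (v : G) := \sum_(e : edge | v \in val e) 1.
pose m := \max_(v : G) inc v.
exists (m + #|G|).+1; apply/has_irregular_labelingP.
exists (fun x => match x with
                 | inl v => (m - inc v + enum_rank v).+1
                 | inr _ => 1
                 end).
split.
  apply/forallP => -[v|e] //=.
  by rewrite ltnS leq_add ?leq_subr // ltnW.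
apply/injectiveP => u v; rewrite /wt -!/(inc _).
have wE (w : G) :
    (m - inc w + enum_rank w).+1 + inc w = (m + enum_rank w).+1.
  by rewrite addSn addnAC subnK //; apply: leq_bigmax.
by rewrite !wE => -[] /addnI /val_inj /enum_rank_inj.
Qed.

Definition tvs : nat := ex_minn exists_irregular_labeling.

End TotalLabelings.

(* Main.v *)
(* Subtract 1 from every label, so that labels range over [0, s] with s + 1 the
   claimed value. Given edge labels with sums sigma(v), sort the vertices by
   sigma and ask for the position of v as its weight: this needs
   sigma(v) <= pos(v) <= sigma(v) + s, which only involves the counting function
   of sigma, and the counting function has to stay in a band of width s.

   Draw x(v) uniformly in {0, ..., m-1} and label uv by s if x(u) + x(v) >= m and by
   0 otherwise (Alon-Wei). By exchangeability the number of s-labels at v is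
   uniform on {0, ..., d} up to ties, which puts the counting function right on the
   boundary of the band. Relabelling by s/2 the edges of a matching that covers
   a positive proportion of the vertices moves it to the interior of the band by
   a margin linear in n. Statistics at vertices with disjoint closed
   neighbourhoods are independent, so by the second moment method some x has
   all its counts within that margin of their means once n is large. *)
Require Import Defs.
From mathcomp Require Import all_boot all_order all_algebra all_fingroup.
From mathcomp Require Import zify ring lra.

Set Implicit Arguments.
Unset Strict Implicit.
Unset Printing Implicit Defensive.
Import Order.TTheory GRing.Theory Num.Theory.

(** * Ranks in a random sample *)

Definition rk (V : finType) (T : {set V}) (y : V -> nat) (i : V) : nat :=
  #|[set u in T | y i < y u]|.

(** Take [i] of largest value among the elements of rank at least [j]: everything above [i] has rank
    below [j], and there are at least [j] such elements. Ties only help, so injectivity is not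
    assumed. *)
Lemma card_rk_ge (V : finType) (T : {set V}) (y : V -> nat) (j : nat) :
  j <= #|T| -> j <= #|[set i in T | rk T y i < j]|.
Proof.
move=> jT; have [TL|] := boolP (T \subset [set i in T | rk T y i < j]).
  exact: leq_trans jT (subset_leq_card TL).
case/subsetPn=> i0 i0T i0N.
have P0 : (i0 \in T) && (j <= rk T y i0).
  by move: i0N; rewrite inE i0T /= -leqNgt.
case: (arg_maxnP (P := fun i => (i \in T) && (j <= rk T y i)) y P0) => i /andP[iT ji] imax.
apply: leq_trans ji _; apply/subset_leq_card/subsetP=> u.
rewrite !inE => /andP[uT iu]; rewrite uT ltnNge /=; apply/negP=> ju.
by have := imax u; rewrite uT ju => /(_ isT); rewrite /= leqNgt iu.
Qed.

(** With distinct values the rank strictly decreases in [y], hence is injective on [T]. *)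
Lemma card_rk_le (V : finType) (T : {set V}) (y : V -> nat) (j : nat) :
  {in T &, injective y} -> #|[set i in T | rk T y i < j]| <= j.
Proof.
move=> yI.
have lt_rk a b : b \in T -> y a < y b -> rk T y b < rk T y a.
  move=> bT ab; apply/proper_card/properP; split.
    by apply/subsetP=> u; rewrite !inE => /andP[-> /(ltn_trans ab)].
  by exists b; rewrite !inE bT ?ab ?ltnn.
case: j => [|j]; first by rewrite leqn0 cards_eq0; apply/eqP/setP=> i; rewrite !inE andbF.
rewrite -[X in _ <= X]card_ord.
pose f i : 'I_j.+1 := inord (rk T y i).
rewrite -(card_in_imset (f := f)) ?max_card // => a b.
rewrite !inE => /andP[aT aj] /andP[bT bj] /(congr1 (@nat_of_ord _)); rewrite !inordK // => E.
apply: yI => //; case: (ltngtP (y a) (y b)) => // /lt_rk.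
  by move=> /(_ bT); rewrite E ltnn.
by move=> /(_ aT); rewrite E ltnn.
Qed.

(** Overwriting the entry at [a] of a tied [x] by an arbitrary value loses nothing, since the old
    entry can still be read off at [b]. *)
Lemma card_tie (V : finType) (m : nat) (a b : V) : a != b ->
  m * #|[set x : {ffun V -> 'I_m} | x a == x b]| <= #|{ffun V -> 'I_m}|.
Proof.
move=> ab; rewrite -[m in m * _]card_ord -cardsT mulnC -cardsX.
pose f (p : {ffun V -> 'I_m} * 'I_m) : {ffun V -> 'I_m} :=
  [ffun u => if u == a then p.2 else p.1 u].
rewrite -(card_in_imset (f := f)) ?max_card //.
case=> [x c] [x' c']; rewrite !inE /= !andbT => /eqP xab /eqP xab' /ffunP E.
have E' u : u != a -> x u = x' u.
  by move=> ua; have := E u; rewrite !ffunE (negPf ua).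
have -> : c = c' by have := E a; rewrite !ffunE eqxx.
congr (_, _); apply/ffunP=> u; have [->|/E'//] := eqVneq u a.
by rewrite xab xab' E' // eq_sym.
Qed.

Lemma card_not_inj (V : finType) (m : nat) (T : {set V}) :
  m * #|[set x : {ffun V -> 'I_m} | ~~ dinjectiveb x T]|
    <= #|T| ^ 2 * #|{ffun V -> 'I_m}|.
Proof.
pose tie (p : V * V) := [set x : {ffun V -> 'I_m} | (p.1 != p.2) && (x p.1 == x p.2)].
have /subset_leq_card H : [set x : {ffun V -> 'I_m} | ~~ dinjectiveb x T]
    \subset \bigcup_(p in setX T T) tie p.
  apply/subsetP=> x; rewrite inE => /dinjectivePn[a aT [b]].
  rewrite !inE => /andP[ba bT] E.
  by apply/bigcupP; exists (a, b); rewrite !inE /= ?aT ?bT // eq_sym ba E eqxx.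
apply: leq_trans (leq_mul (leqnn m) H) _.
apply: (@leq_trans (m * \sum_(p in setX T T) #|tie p|)).
  rewrite leq_mul2l; apply/orP; right.
  elim/big_rec2: _ => [|p k A _ IH]; first by rewrite cards0.
  by apply: leq_trans (leq_card_setU _ _) _; rewrite leq_add2l.
rewrite big_distrr /= -mulnn -cardsX -sum_nat_const.
apply: leq_sum => -[a b] _; have [->|ab] := eqVneq a b.
  by rewrite (_ : tie _ = set0) ?cards0 ?muln0 //; apply/setP=> x; rewrite !inE eqxx.
rewrite (_ : tie _ = [set x : {ffun V -> 'I_m} | x a == x b]) ?card_tie //.
by apply/setP=> x; rewrite !inE ab.
Qed.

(** Exchangeability: precomposing samples with the transposition of [i] and [k] exchanges the two
    events. *)
Lemma card_rk_swap (V : finType) (m : nat) (T : {set V}) (i k : V) (j : nat) :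
  i \in T -> k \in T ->
  #|[set x : {ffun V -> 'I_m} | rk T (fun u => x u) i < j]| =
  #|[set x : {ffun V -> 'I_m} | rk T (fun u => x u) k < j]|.
Proof.
move=> iT kT; pose t := tperm i k.
pose f (x : {ffun V -> 'I_m}) : {ffun V -> 'I_m} := [ffun u => x (t u)].
have fK : involutive f by move=> x; apply/ffunP=> u; rewrite !ffunE tpermK.
have tT u : (t u \in T) = (u \in T).
  by rewrite /t; case: tpermP => [->|->|//]; rewrite iT kT.
rewrite -(card_imset _ (inv_inj fK)); apply: eq_card => x.
apply/imsetP/idP=> [[z zi ->]|xk].
  move: zi; rewrite !inE; congr (_ < _); rewrite /rk.
  rewrite -(card_imset _ (@perm_inj _ t)).
  rewrite (_ : [set t x | x in _] = [set u in T | f z k < f z u]) //.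
  apply/setP=> u; apply/imsetP/idP=> [[w wP ->]|uP].
    by move: wP; rewrite !inE !ffunE tT tpermR tpermK.
  exists (t u); last by rewrite tpermK.
  by move: uP; rewrite !inE !ffunE tT tpermR.
exists (f x); last by rewrite fK.
move: xk; rewrite !inE; congr (_ < _); rewrite /rk.
rewrite -(card_imset _ (@perm_inj _ t)).
rewrite (_ : [set t x | x in _] = [set u in T | f x i < f x u]) //.
apply/setP=> u; apply/imsetP/idP=> [[w wP ->]|uP].
  by move: wP; rewrite !inE !ffunE tT tpermL tpermK.
exists (t u); last by rewrite tpermK.
by move: uP; rewrite !inE !ffunE tT tpermL.
Qed.

(** The number of [s]-labels on the edges from [v] to [S] in the Alon-Wei labeling. Later [S] is the
    set of neighbours of [v] without its matching partner. *)
Definition cnt (V : finType) (m : nat) (S : {set V}) (v : V)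
    (x : {ffun V -> 'I_m}) : nat :=
  #|[set u in S | m <= x u + x v]|.

(* Replacing [x v] by [m - 1 - x v] turns [m <= x u + x v] into [x v < x u]. *)
Lemma card_cnt (V : finType) (m : nat) (S : {set V}) (v : V) (j : nat) :
  v \notin S ->
  #|[set x : {ffun V -> 'I_m} | cnt S v x < j]| =
  #|[set x : {ffun V -> 'I_m} | rk (v |: S) (fun u => x u) v < j]|.
Proof.
move=> vS.
pose f (x : {ffun V -> 'I_m}) : {ffun V -> 'I_m} :=
  [ffun u => if u == v then rev_ord (x u) else x u].
have fK : involutive f.
  by move=> x; apply/ffunP=> u; rewrite !ffunE; case: eqP => // _; rewrite rev_ordK.
have E x : rk (v |: S) (fun u => f x u) v = cnt S v x.
  apply: eq_card => u; rewrite !inE !ffunE eqxx /=.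
  have [->|uv] := eqVneq u v; first by rewrite (negPf vS) ltnn.
  by case: (u \in S) => //=; have := ltn_ord (x v); lia.
rewrite -(card_imset _ (inv_inj fK)); apply: eq_card => x.
apply/imsetP/idP=> [[z zi ->]|xk]; first by move: zi; rewrite !inE E.
by exists (f x); rewrite ?fK //; move: xk; rewrite !inE -E fK.
Qed.

Lemma sum_card_rk (V : finType) (m : nat) (T : {set V}) (v : V) (j : nat) :
  v \in T ->
  #|T| * #|[set x : {ffun V -> 'I_m} | rk T (fun u => x u) v < j]| =
  \sum_(x : {ffun V -> 'I_m}) #|[set i in T | rk T (fun u => x u) i < j]|.
Proof.
move=> vT.
under eq_bigr => x _ do rewrite -sum1_card big_mkcond.
rewrite exchange_big /= (bigID (mem T)) /= [X in _ + X]big1 ?addn0; last first.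
  by move=> i /negPf iT; rewrite big1 // => x _; rewrite inE iT.
rewrite -sum_nat_const; apply: eq_bigr => i iT.
rewrite (card_rk_swap m j vT iT) -sum1_card big_mkcond.
by apply: eq_bigr => x _; rewrite !inE iT.
Qed.

(** In probabilities: the event has probability at least j/(|S|+1), with no loss from ties. *)
Lemma card_cnt_ge (V : finType) (m : nat) (S : {set V}) (v : V) (j : nat) :
  v \notin S -> j <= #|S|.+1 ->
  j * #|{ffun V -> 'I_m}| <= #|S|.+1 * #|[set x : {ffun V -> 'I_m} | cnt S v x < j]|.
Proof.
move=> vS jS; have cT : #|v |: S| = #|S|.+1 by rewrite cardsU1 vS.
rewrite card_cnt // -cT sum_card_rk ?setU11 // mulnC -sum_nat_const.
by apply: leq_sum => x _; apply: card_rk_ge; rewrite cT.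
Qed.

(** With k = |S|+1, the event has probability at most j/k + k^2/m; the second term is the union
    bound for a tie within [v |: S]. *)
Lemma card_cnt_le (V : finType) (m : nat) (S : {set V}) (v : V) (j : nat) :
  v \notin S ->
  m * (#|S|.+1 * #|[set x : {ffun V -> 'I_m} | cnt S v x < j]|)
    <= (m * j + #|S|.+1 ^ 3) * #|{ffun V -> 'I_m}|.
Proof.
move=> vS; have cT : #|v |: S| = #|S|.+1 by rewrite cardsU1 vS.
rewrite card_cnt // -cT sum_card_rk ?setU11 //; set T := v |: S.
(* Samples with a tie get the trivial bound [#|T|]. *)
apply: (@leq_trans (m * (\sum_(x : {ffun V -> 'I_m})
    (j + #|T| * ~~ dinjectiveb x T)))).
  rewrite leq_mul2l; apply/orP; right; apply: leq_sum => x _.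
  have [/dinjectiveP xI|_] := boolP (dinjectiveb x T).
    rewrite muln0 addn0; apply: card_rk_le => a b aT bT /ord_inj; exact: xI.
  rewrite muln1; apply: leq_trans (leq_addl _ _).
  by apply: subset_leq_card; apply/subsetP=> i; rewrite inE => /andP[].
rewrite big_split /= sum_nat_const -big_distrr /= mulnDr mulnDl leq_add //.
  by rewrite mulnA mulnAC.
have -> : \sum_(x : {ffun V -> 'I_m}) (~~ dinjectiveb x T : nat) =
    #|[set x : {ffun V -> 'I_m} | ~~ dinjectiveb x T]|.
  by rewrite -sum1_card [RHS]big_mkcond; apply: eq_bigr => x _; rewrite inE; case: dinjectiveb.
rewrite mulnCA expnS -mulnA leq_mul2l; apply/orP; right.
exact: card_not_inj.
Qed.

(** * Second moment method *)

(** Independence of functions of disjoint sets of coordinates. The involution on pairs of samples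
    that exchanges the coordinates outside [A] turns the sum of [F x * G y] into that of
    [F x * G x]. *)
Lemma sum_mul_indep (V K : finType) (A : {set V}) (F G : {ffun V -> K} -> rat) :
  (forall x y : {ffun V -> K}, {in A, x =1 y} -> F x = F y) ->
  (forall x y : {ffun V -> K}, {in ~: A, x =1 y} -> G x = G y) ->
  ((\sum_x F x * G x) * #|{ffun V -> K}|%:R = (\sum_x F x) * (\sum_x G x))%R.
Proof.
move=> FA GA.
pose mix (x y : {ffun V -> K}) : {ffun V -> K} := [ffun u => if u \in A then x u else y u].
have -> : ((\sum_x F x) * (\sum_x G x) =
    \sum_(p : {ffun V -> K} * {ffun V -> K}) F p.1 * G p.2)%R.
  rewrite mulr_suml -(pair_bigA _ (fun x y => F x * G y)%R) /=.
  by apply: eq_bigr => x _; rewrite mulr_sumr.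
pose f (p : {ffun V -> K} * {ffun V -> K}) := (mix p.1 p.2, mix p.2 p.1).
have fK : involutive f.
  by move=> [x y]; rewrite /f /=; congr pair; apply/ffunP=> u;
    rewrite !ffunE /=; case: (u \in A).
rewrite (reindex_inj (inv_inj fK)) /=.
have -> : (\sum_(p : {ffun V -> K} * {ffun V -> K}) F (mix p.1 p.2) * G (mix p.2 p.1) =
   \sum_(p : {ffun V -> K} * {ffun V -> K}) F p.1 * G p.1)%R.
  apply: eq_bigr => -[x y] _ /=; congr (_ * _)%R.
    by apply: FA => u uA; rewrite ffunE uA.
  by apply: GA => u; rewrite inE ffunE => /negPf->.
rewrite -(pair_bigA _ (fun x y => F x * G x)%R) /= mulr_suml.
by apply: eq_bigr => x _; rewrite sumr_const mulr_natr.
Qed.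

Definition mean (X : finType) (P : pred X) : rat := (#|[set x | P x]|%:R / #|X|%:R)%R.

(** Second moment bound: covariances vanish when the sets [N v] and [N w] are disjoint, and each
    vertex leaves at most [C] other terms, each at most 1. Summing the squared deviations over [I]
    before averaging lets a single [x] serve all indices. *)
Lemma exists_concentrated (V K I : finType) (N : V -> {set V})
    (F : I -> V -> pred {ffun V -> K}) (C : nat) :
  (forall i v (x y : {ffun V -> K}), {in N v, x =1 y} -> F i v x = F i v y) ->
  (forall v, #|[set w | ~~ [disjoint N v & N w]]| <= C) ->
  0 < #|{ffun V -> K}| ->
  exists x, forall i,
    ((\sum_v ((F i v x)%:R - mean (F i v))) ^+ 2 <= (#|I| * (#|V| * C))%:R)%R.
Proof.
move=> FN NC X0.
have X0' : (#|{ffun V -> K}|%:R != 0 :> rat)%R by rewrite pnatr_eq0 -lt0n.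
pose D i v x : rat := ((F i v x)%:R - mean (F i v))%R.
have mean01 i v : (0 <= mean (F i v) <= 1)%R.
  rewrite divr_ge0 ?ler0n //= ler_pdivrMr ?ltr0n // mul1r ler_nat.
  exact: max_card.
have D1 i v w x : (D i v x * D i w x <= 1)%R.
  have := mean01 i v; have := mean01 i w; rewrite /D.
  by case: (F i v x); case: (F i w x) => /= /andP[? ?] /andP[? ?]; nra.
have D0 i v : (\sum_x D i v x = 0)%R.
  rewrite big_split /= sumr_const mulNrn -mulr_natr divfK // -natr_sum.
  rewrite -[#|[set x | _]|]sum1_card [in X in (_ - X)%R]big_mkcond.
  by apply/eqP; rewrite subr_eq0; apply/eqP; congr (_%:R)%R;
    apply: eq_bigr => x _; rewrite inE; case: (F i v x).
have Dind i v w : [disjoint N v & N w] -> (\sum_x D i v x * D i w x = 0)%R.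
  move=> vw; apply: (mulIf X0'); rewrite mul0r (@sum_mul_indep _ _ (N v)) ?D0 ?mul0r //.
    by move=> x y xy; rewrite /D (FN i v x y).
  move=> x y xy; rewrite /D (FN i w x y) // => u uw; apply: xy.
  by rewrite inE; move: vw; rewrite disjoint_sym => /disjointFr ->.
pose Q x : rat := (\sum_i (\sum_v D i v x) ^+ 2)%R.
have QC : (\sum_x Q x <= #|{ffun V -> K}|%:R * (#|I| * (#|V| * C))%:R)%R.
  rewrite exchange_big /= natrM mulrCA mulr_natl -sumr_const.
  apply: ler_sum => i _; rewrite natrM mulrCA mulr_natl -sumr_const.
  have -> : (\sum_x (\sum_v D i v x) ^+ 2 =
      \sum_v \sum_w \sum_x D i v x * D i w x)%R.
    under eq_bigr => x _ do rewrite expr2 mulr_suml.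
    rewrite exchange_big; apply: eq_bigr => v _.
    under eq_bigr => x _ do rewrite mulr_sumr.
    by rewrite exchange_big.
  apply: ler_sum => v _.
  rewrite (bigID (fun w => [disjoint N v & N w])) /= big1 ?add0r; last by move=> w /Dind->.
  apply: (@le_trans _ _ (\sum_(w | ~~ [disjoint N v & N w]) #|{ffun V -> K}|%:R)%R).
    by apply: ler_sum => w _; rewrite -sumr_const; apply: ler_sum.
  rewrite sumr_const mulr_natr -[X in (X *+ _)%R]mulr1n -!mulrnA !mul1n ler_nat.
  by rewrite leq_mul2l -cardsE NC orbT.
(* Some sample is at most the average of [Q]; each single square is then bounded by the whole of
   [Q x]. *)
have [x Hx] : exists x, (Q x <= (#|I| * (#|V| * C))%:R)%R.
  apply/existsP; apply: contraLR QC => /existsPn H.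
  rewrite -ltNge mulr_natl -sumr_const.
  have [x0 _] : exists x0 : {ffun V -> K}, true by case/card_gt0P: X0 => x0 _; exists x0.
  apply: ltr_sum => [|x _]; last by rewrite ltNge.
  by apply/hasP; exists x0; rewrite ?mem_index_enum.
exists x => i; apply: le_trans Hx; rewrite /Q (bigD1 i) //=.
by rewrite lerDl sumr_ge0 // => k _; exact: sqr_ge0.
Qed.

(** The allowed error n/D is split in two halves: one for the bias due to ties, one for the
    deviation from the mean. *)
Lemma exists_balanced (G : sgraph) (d D : nat) (S : G -> {set G}) (I : finType)
    (B : I -> {set G}) (t : I -> nat) :
  (forall v : G, deg v <= d) -> (forall v, S v \subset [set u | adj v u]) ->
  (forall i v, v \in B i -> t i <= #|S v|.+1) ->
  0 < D -> 4 * D ^ 2 * (#|I| * d.+1 ^ 2) <= #|G| ->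
  exists m (x : {ffun G -> 'I_m}), forall i,
    (`|#|[set v in B i | (cnt (S v) v x < t i)%N]|%:R
      - \sum_(v in B i) (t i)%:R / #|S v|.+1%:R| <= #|G|%:R / D%:R :> rat)%R.
Proof.
move=> Gd SN tS D0 GD.
(* This makes the tie bias of each vertex, at most (d+1)^2/m, at most 1/(2D). *)
pose m := (2 * D * d.+1 ^ 2)%N.
have m0 : 0 < m by rewrite /m !muln_gt0 D0.
have X0 : 0 < #|{ffun G -> 'I_m}| by rewrite card_ffun card_ord expn_gt0 m0.
pose F i v (x : {ffun G -> 'I_m}) : bool := (v \in B i) && (cnt (S v) v x < t i)%N.
pose N (v : G) := v |: [set u | adj v u].
have cN v : #|N v| <= d.+1.
  by rewrite cardsU1 -[d.+1]add1n leq_add ?leq_b1 // Gd.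
have NC u v : (u \in N v) = (v \in N u) by rewrite !inE eq_sym adj_sym.
have [||//|x Hx] := @exists_concentrated _ _ _ N F (d.+1 ^ 2).
- move=> i v x y xy; rewrite /F; congr (_ && (_ < _)); apply: eq_card => u.
  rewrite !inE; have [uS|//] := boolP (u \in S v).
  rewrite !xy ?setU11 // in_setU; apply/orP; right; exact: (subsetP (SN v)).
(* A closed neighbourhood meeting [N v] is centred in [N u] for some [u] in [N v], which leaves at
   most (d+1)^2 centres. *)
- move=> v; apply: (@leq_trans #|\bigcup_(u in N v) N u|).
    apply/subset_leq_card/subsetP=> w; rewrite inE => /pred0Pn[u /andP[uv uw]].
    by apply/bigcupP; exists u; rewrite // NC.
  apply: (@leq_trans (\sum_(u in N v) #|N u|)).
    elim/big_rec2: _ => [|w k A _ IH]; first by rewrite cards0.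
    by apply: leq_trans (leq_card_setU _ _) _; rewrite leq_add2l.
  apply: (@leq_trans (\sum_(u in N v) d.+1)); first by apply: leq_sum.
  by rewrite sum_nat_const -mulnn leq_mul2r cN.
exists m, x => i.
have Dr : (0 < D%:R :> rat)%R by rewrite ltr0n.
have mr : (0 < m%:R :> rat)%R by rewrite ltr0n.
have Xr : (0 < #|{ffun G -> 'I_m}|%:R :> rat)%R by rewrite ltr0n.
have vS v : v \notin S v.
  by apply/negP=> /(subsetP (SN v)); rewrite inE adj_irrefl.
have cS v : #|S v| <= d by exact: leq_trans (subset_leq_card (SN v)) (Gd v).
have meanB v : v \in B i -> mean (F i v) =
    (#|[set x : {ffun G -> 'I_m} | (cnt (S v) v x < t i)%N]|%:R / #|{ffun G -> 'I_m}|%:R)%R.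
  by move=> vB; rewrite /mean /F vB.
have -> : #|[set v in B i | cnt (S v) v x < t i]| = \sum_v (F i v x : nat).
  by rewrite -sum1_card [LHS]big_mkcond; apply: eq_bigr => v _;
    rewrite inE -/(F i v x); case: (F i v x).
have {}Hx := Hx i; rewrite sumrB -natr_sum in Hx.
set Z := (_%:R)%R in Hx *; set M := (\sum_v mean _)%R in Hx.
have ME : M = (\sum_(v in B i) mean (F i v))%R.
  rewrite /M (bigID (mem (B i))) /= [X in (_ + X)%R]big1 ?addr0 //.
  move=> v /negPf vB; rewrite /mean (_ : [set _ | _] = set0) ?cards0 ?mul0r //.
  by apply/setP=> y; rewrite !inE /F vB.
have lo : (\sum_(v in B i) (t i)%:R / #|S v|.+1%:R <= M)%R.
  rewrite ME; apply: ler_sum => v vB; rewrite meanB // ler_pdivrMr ?ltr0n //.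
  rewrite mulrAC ler_pdivlMr // -!natrM ler_nat mulnC [X in _ <= X]mulnC.
  by rewrite mulnC; apply: card_cnt_ge; rewrite ?tS.
have up : (M <= \sum_(v in B i) (t i)%:R / #|S v|.+1%:R + #|G|%:R / (2 * D)%:R)%R.
  apply: (@le_trans _ _ (\sum_(v in B i) ((t i)%:R / #|S v|.+1%:R + (2 * D)%:R^-1))%R).
    rewrite ME; apply: ler_sum => v vB; rewrite meanB //.
    set k := #|S v|.+1; have k0 : (0 < k%:R :> rat)%R by rewrite ltr0n.
    have kd : (k%:R ^+ 2 <= d.+1%:R ^+ 2 :> rat)%R.
      by rewrite -!natrX ler_nat leq_sqr ltnS cS.
    rewrite ler_pdivrMr // -(ler_pM2l mr) -(ler_pM2l k0).
    apply: le_trans (_ : (m%:R * (t i)%:R + k%:R ^+ 3) * #|{ffun G -> 'I_m}|%:R <= _)%R.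
      by rewrite -natrX -!natrM -natrD -natrM ler_nat mulnCA card_cnt_le.
    rewrite !mulrA ler_pM2r // (_ : _ * (_ + _) = m%:R * (t i)%:R + k%:R * d.+1%:R ^+ 2)%R.
      by rewrite lerD2l exprS ler_pM2l.
    rewrite /m !natrM; field; rewrite !pnatr_eq0 -!lt0n D0 -(ltr0n rat) k0 //.
  rewrite big_split /= lerD2l sumr_const -[leLHS]mulr_natl.
  rewrite ler_pM2r ?invr_gt0 ?ltr0n ?muln_gt0 //.
  by rewrite ler_nat max_card.
(* The squared deviation is at most |I| n (d+1)^2, and [GD] says exactly that this is at most
   (n/(2D))^2. *)
have : (`|Z - M| <= #|G|%:R / (2 * D)%:R)%R.
  have n0 : (0 <= #|G|%:R / (2 * D)%:R :> rat)%R by rewrite divr_ge0 ?ler0n.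
  rewrite -(ler_pXn2r (n := 2)) ?nnegrE ?normr_ge0 // real_normK ?num_real //.
  apply: le_trans Hx _; rewrite expr_div_n ler_pdivlMr ?exprn_gt0 ?ltr0n ?muln_gt0 //.
  rewrite -!natrX -natrM ler_nat -[in X in _ <= X]mulnn.
  have := leq_mul (leqnn #|G|) GD; lia.
rewrite natrM invfM mulrCA in up *; move=> /ler_normlP[H1 H2].
rewrite ler_norml; lra.
Qed.

(** * Matchings and edge labels *)

(* A matching is encoded by the involution swapping the ends of its edges. *)
Lemma exists_matching (G : sgraph) (d q : nat) : regular G d -> 0 < d ->
  q * (2 * d.+1) <= #|G| ->
  exists p : G -> G, [/\ involutive p, (forall v, p v != v -> adj v (p v))
    & #|[set v | p v != v]| = q.*2].
Proof.
move=> Gd d0; elim: q => [|q IH] qG.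
  exists id; split=> // [v|]; first by rewrite eqxx.
  by apply: eq_card0 => v; rewrite inE eqxx.
case: IH => [|p [pK pA pc]]; first by apply: leq_trans qG; rewrite leq_mul2r leqnSn orbT.
set T := [set v | p v != v] in pc.
have [u /andP[uT uN]] : exists u, (u \notin T) && [forall w, adj u w ==> (w \notin T)].
  apply/existsP; apply: contraLR qG => /existsPn H; rewrite -ltnNge.
  have /subset_leq_card : [set: G] \subset T :|: \bigcup_(w in T) [set u | adj w u].
    apply/subsetP=> u _; rewrite inE; have := H u; case: (u \in T) => //=.
    case/forallPn=> w; rewrite negb_imply negbK => /andP[uw wT].
    by apply/bigcupP; exists w; rewrite // inE adj_sym.
  rewrite cardsT => /leq_ltn_trans; apply.
  apply: leq_ltn_trans (leq_card_setU _ _) _.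
  have : #|\bigcup_(w in T) [set u | adj w u]| <= \sum_(w in T) #|[set u | adj w u]|.
    elim/big_rec2: _ => [|w k A _ IH']; first by rewrite cards0.
    by apply: leq_trans (leq_card_setU _ _) _; rewrite leq_add2l.
  rewrite (eq_bigr (fun=> d)) => [|w _]; last exact: Gd.
  by rewrite sum_nat_const pc; lia.
have [w uw] : exists w, adj u w.
  have : 0 < deg u by rewrite Gd.
  by case/card_gt0P=> w; rewrite inE; exists w.
have wT : w \notin T by move/forallP: uN => /(_ w); rewrite uw.
have wu : w != u by apply: contraTneq uw => ->; rewrite adj_irrefl.
have pu : p u = u by move: uT; rewrite inE negbK => /eqP.
have pw : p w = w by move: wT; rewrite inE negbK => /eqP.
(* As [p] fixes [u] and [w], composing with their transposition adds this pair and changes nothing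
   else. *)
exists (fun v => tperm u w (p v)).
have tE v : v != u -> v != w -> tperm u w (p v) = p v.
  move=> vu vw; rewrite tpermD //; apply/eqP=> E.
    by move: vu; rewrite -[v]pK -E pu eqxx.
  by move: vw; rewrite -[v]pK -E pw eqxx.
split=> [v|v|].
- have [->|vu] := eqVneq v u; first by rewrite pu tpermL pw tpermR.
  have [->|vw] := eqVneq v w; first by rewrite pw tpermR pu tpermL.
  by rewrite (tE v) // pK tpermD // eq_sym.
- have [->|vu] := eqVneq v u; first by rewrite pu tpermL.
  have [->|vw] := eqVneq v w; first by rewrite pw tpermR adj_sym.
  by rewrite tE //; apply: pA.
- rewrite (_ : [set v | _] = u |: (w |: T)).
    by rewrite !cardsU1 wT in_setU1 (negPf uT) eq_sym (negPf wu) pc doubleS.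
  apply/setP=> v; rewrite !inE; have [->|vu] := eqVneq v u; first by rewrite pu tpermL.
  have [->|vw] := eqVneq v w; first by rewrite pw tpermR eq_sym.
  by rewrite tE.
Qed.

Lemma set2_inj (T : finType) (a b u v : T) : u != v -> [set a; b] = [set u; v] ->
  (a = u /\ b = v) \/ (a = v /\ b = u).
Proof.
move=> uv /setP S; move: (S a) (S b) (S u) (S v); rewrite !inE !eqxx ?orbT.
move=> /esym/orP[]/eqP-> /esym/orP[]/eqP->; [|by left|by right|] => Eu Ev.
  by move: uv Ev; rewrite orbb eq_sym => /negPf->.
by move: uv Eu; rewrite orbb => /negPf->.
Qed.

Lemma edge_ends (G : sgraph) (e : edge G) :
  exists p : G * G, adj p.1 p.2 && (val e == [set p.1; p.2]).
Proof.
by case: e => A /=; rewrite inE => /existsP[u /existsP[v uv]]; exists (u, v).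
Qed.

Lemma edge_of_adj (G : sgraph) (u v : G) : adj u v -> exists e : edge G, val e = [set u; v].
Proof.
move=> uv; suff H : [set u; v] \in edges G by exists (exist (fun e => e \in edges G) _ H).
by rewrite inE; apply/existsP; exists u; apply/existsP; exists v; rewrite uv /=.
Qed.

(** Passes from symmetric functions of ordered pairs to labels of edges as two-element sets, so that
    vertex sums become sums over neighbours. *)
Lemma exists_edge_labels (G : sgraph) (g : G -> G -> nat) :
  (forall u v, g u v = g v u) ->
  exists f : edge G -> nat,
    (forall e, exists u v, f e = g u v) /\
    (forall v, \sum_(e : edge G | v \in val e) f e = \sum_(u | adj v u) g v u).
Proof.
move=> gC.
pose ends (e : edge G) := xchoose (edge_ends e).
have endsE e : adj (ends e).1 (ends e).2 /\ val e = [set (ends e).1; (ends e).2].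
  by have /andP[? /eqP] := xchooseP (edge_ends e).
exists (fun e => g (ends e).1 (ends e).2); split=> [e|v].
  by exists (ends e).1, (ends e).2.
have adjN (a b : G) : adj a b -> a != b.
  by move=> ab; apply: contraTneq ab => ->; rewrite adj_irrefl.
(* For edges at [v], the end different from [v]; it puts these edges in bijection with the
   neighbours of [v]. *)
pose other e := if (ends e).1 == v then (ends e).2 else (ends e).1.
rewrite (partition_big other (fun u => adj v u)) /=; last first.
  move=> e; have [ab ->] := endsE e; rewrite /other !inE !(eq_sym v).
  by case: eqP => [<- //|_ /= /eqP <-]; rewrite adj_sym.
apply: eq_bigr => u vu; have [eu euE] := edge_of_adj vu.
have [[E1 E2]|[E1 E2]] : ((ends eu).1 = v /\ (ends eu).2 = u) \/
    ((ends eu).1 = u /\ (ends eu).2 = v).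
- by apply: set2_inj; [exact: adjN | rewrite -euE -(proj2 (endsE eu))].
- rewrite (big_pred1 eu) ?E1 ?E2 // => e /=.
  apply/andP/eqP=> [[ve /eqP oe]|->]; last by rewrite euE /other E1 E2 !inE !eqxx.
  apply: val_inj; rewrite /= euE -oe /other; move: ve; have [_ ->] := endsE e.
  by rewrite !inE !(eq_sym v); case: eqP => [-> //|_ /= /eqP ->]; rewrite setUC.
- rewrite (big_pred1 eu) ?E1 ?E2 1?gC // => e /=.
  apply/andP/eqP=> [[ve /eqP oe]|->].
    apply: val_inj; rewrite /= euE -oe /other; move: ve; have [_ ->] := endsE e.
    by rewrite !inE !(eq_sym v); case: eqP => [-> //|_ /= /eqP ->]; rewrite setUC.
  by rewrite euE /other E1 E2 !inE !eqxx (eq_sym u) (negPf (adjN _ _ vu)) /=.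
Qed.

Lemma sum_edge1 (G : sgraph) (v : G) : \sum_(e : edge G | v \in val e) 1 = deg v.
Proof.
have [f1 [f1E f1sum]] := @exists_edge_labels G (fun _ _ => 1) (fun _ _ => erefl).
rewrite (eq_bigr f1) => [|e _]; last by have [? [? ->]] := f1E e.
by rewrite f1sum sum1_card -cardsE.
Qed.

(* Sort the vertices by [sig]; the shifted weight of a vertex is its position. *)
Lemma irregular_of_counts (G : sgraph) (s : nat) (g : G -> G -> nat) (sig : G -> nat) :
  (forall u v, g u v = g v u) -> (forall u v, g u v <= s) ->
  (forall v, \sum_(u | adj v u) g v u = sig v) ->
  (forall v, sig v <= #|[set u | sig u < sig v]|) ->
  (forall v, #|[set u | sig u <= sig v]| <= (sig v + s).+1) ->
  forall d, regular G d -> has_irregular_labeling G s.+1.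
Proof.
move=> gC gs sigE lo up d Gd.
have [f [fg fsum]] := exists_edge_labels gC.
(* Ties of [sig] are broken by the enumeration, so that positions are distinct. *)
pose R u v := (sig u < sig v) || ((sig u == sig v) && (enum_rank u < enum_rank v)).
pose pos v := #|[set u | R u v]|.
have R_lt u v : R u v -> pos u < pos v.
  move=> uv; apply/proper_card/properP; split.
    apply/subsetP=> w; rewrite !inE /R in uv *; lia.
  by exists u; rewrite !inE // /R !ltnn andbF.
have pos_inj : injective pos.
  move=> u v E; case: (ltngtP (sig u) (sig v)) => uv.
  - by have := R_lt u v; rewrite /R uv E ltnn => /(_ isT).
  - by have := R_lt v u; rewrite /R uv E ltnn => /(_ isT).
  apply/enum_rank_inj/val_inj => /=.
  case: (ltngtP (enum_rank u) (enum_rank v)) => // r.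
  - by have := R_lt u v; rewrite /R uv eqxx r orbT E ltnn => /(_ isT).
  - by have := R_lt v u; rewrite /R uv eqxx r orbT E ltnn => /(_ isT).
have pos_lo v : sig v <= pos v.
  apply: leq_trans (lo v) _; apply/subset_leq_card/subsetP=> u.
  by rewrite !inE /R => ->.
(* The set in [up] contains [v] itself while [pos v] does not count it; this absorbs the
   successor. *)
have pos_up v : pos v <= sig v + s.
  rewrite -ltnS; apply: leq_trans (up v); apply/proper_card/properP; split.
    by apply/subsetP=> u; rewrite !inE /R; lia.
  by exists v; rewrite !inE ?leqnn // /R !ltnn andbF.
apply/has_irregular_labelingP.
exists (fun x => match x with inl v => (pos v - sig v).+1 | inr e => (f e).+1 end).
split.
  apply/forallP=> -[v|e] /=.
    by rewrite ltnS leq_subLR pos_up.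
  by have [u [v ->]] := fg e; rewrite ltnS gs.
(* Undoing the shift by 1 on the vertex and its d edges adds d+1 to the position. *)
have wtE v : wt (fun x : G + edge G => match x with
    inl v => (pos v - sig v).+1 | inr e => (f e).+1 end) v = pos v + d.+1.
  rewrite /wt; under eq_bigr => e _ do rewrite -addn1.
  rewrite big_split /= fsum sigE.
  rewrite sum_edge1 Gd.
  by have := pos_lo v; lia.
by apply/injectiveP => u v; rewrite !wtE => /addIn /pos_inj.
Qed.

(** A vertex weight is a sum of d+1 labels, so the weights are distinct integers between d+1 and
    (d+1)k. *)
Lemma order_le_of_irregular (G : sgraph) (d k : nat) : regular G d ->
  has_irregular_labeling G k -> 0 < #|G| -> #|G| + d <= d.+1 * k.
Proof.
move=> Gd /has_irregular_labelingP[lam [/forallP tl /injectiveP ir]] /card_gt0P[v0 _].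
have lo v : d.+1 <= wt lam v.
  rewrite /wt -add1n leq_add //; first by case/andP: (tl (inl v)).
  rewrite -(Gd v) -sum_edge1; apply: leq_sum => e _; by case/andP: (tl (inr e)).
have up v : wt lam v <= d.+1 * k.
  rewrite /wt mulSn leq_add //; first by case/andP: (tl (inl v)).
  rewrite -(Gd v) -sum_edge1 big_distrl /=; apply: leq_sum => e _.
  by rewrite mul1n; case/andP: (tl (inr e)).
have k0 := leq_trans (lo v0) (up v0).
pose f v : 'I_(d.+1 * k - d) := Ordinal (n := d.+1 * k - d) (m := wt lam v - d.+1)
  ltac:(have := lo v; have := up v; lia).
have : #|G| <= #|'I_(d.+1 * k - d)|.
  apply: (leq_card f) => u v /(congr1 (@nat_of_ord _)) /= E; apply: ir.
  by have := lo u; have := lo v; lia.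
by rewrite card_ord; lia.
Qed.

(** * Regular graphs *)

Local Open Scope ring_scope.

(* [N] stands for n / (8 (d + 1)). *)
Lemma balanced_bounds (d s h N T j : rat) (A B A' B' : rat) :
  let n := 8 * (d + 1) * N in let U := n - T in
  2 <= d -> (d + 1) ^+ 2 <= N -> 4 * N - 2 <= T -> T <= 4 * N ->
  n - 1 <= (d + 1) * s -> (d + 1) * s <= n + d - 1 ->
  s - 1 <= 2 * h -> 2 * h <= s -> 0 <= j -> j + 1 <= d ->
  `|d * (d + 1) * A - d * U * j| <= N -> `|d * (d + 1) * B - (d + 1) * T * j| <= N ->
  `|d * (d + 1) * A' - d * U * (j + 1)| <= N ->
  `|d * (d + 1) * B' - (d + 1) * T * (j + 1)| <= N ->
  [/\ s * (j + 1) <= A' + B', s * j + h <= A' + B, A' + B <= s * (j + 1) + 1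
    & A' + B' <= s * (j + 1) + h + 1].
Proof.
move=> n U d2 dN T1 T2 s1 s2 h1 h2 j0 jd.
have d0 : 0 <= d by clear -d2; lra.
have j1 : 0 <= j + 1 by clear -j0; lra.
have d1 : 0 <= d + 1 by clear -d0; lra.
have dd : 0 <= d * d by exact: mulr_ge0.
have N0 : 0 <= N by apply: le_trans dN; apply: exprn_ge0.
have dP0 : 0 < d * (d + 1) by apply: mulr_gt0; clear -d2; lra.
have T0 : 0 <= T by apply: le_trans T1; clear -N0 dN d0 dd; lra.
have jd0 : 0 <= d - (j + 1) by rewrite subr_ge0.
move=> /ler_normlP[A1 A2] /ler_normlP[B1 B2] /ler_normlP[A3 A4] /ler_normlP[B3 B4].
rewrite /U /n in A1 A2 A3 A4 s1 s2 *.
(* The goals are nonlinear; the following facts supply the products needed for [lra] to treat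
   monomials as atoms. *)
have e1 := ler_wpM2l (mulr_ge0 d0 j1) s2.
have e2 := ler_wpM2l (mulr_ge0 d0 j1) s1.
have e4 := ler_wpM2l d0 s1.
have h3 := ler_wpM2l (ltW dP0) h2.
have h4 := ler_wpM2l (ltW dP0) h1.
have t1 := ler_wpM2l j0 T1.
have t2 := ler_wpM2l j0 T2.
have t3 := ler_wpM2l d0 T2.
have jT := mulr_ge0 j0 T0.
have t4 := mulr_ge0 jd0 T0.
have q1 := ler_wpM2l j0 dN.
have q3 := mulr_ge0 jd0 N0.
have q4 := mulr_ge0 jd0 d0.
have q5 := ler_wpM2r N0 d2.
have q6 := ler_wpM2l d0 q5.
have q7 := mulr_ge0 jd0 dd.
have q8 := ler_wpM2l dd dN.
have q9 := mulr_ge0 j0 d0.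
have q10 := mulr_ge0 j0 dd.
have q11 := mulr_ge0 dd d0.
have q12 := mulr_ge0 dd dd.
(* After scaling by [d * (d + 1)], the matching gives the first and third bounds margins
   [T * (j + 1)] and [T * (d - j)], at least about 4N, against 2N for the two deviations. The second
   and fourth bounds have room of order s/2. *)
split; rewrite -(ler_pM2l dP0).
- (clear -A3 B3 e1 T1 t1 q1 dN d0 dd q9 q10 j0; lra).
- (clear -A3 B1 e1 e4 h3 t3 jT q5 q6 q7 q8 q9 q11 q12 d0 dd; lra).
- (clear -A4 B2 e2 t4 T1 dN d0 dd q4; lra).
- (clear -A4 B4 e2 h4 e4 t2 T2 q3 q5 q6 q8 q4 dd d0 q11 q12; lra).
Qed.

Local Close Scope ring_scope.

(** The order that [exists_balanced] asks for with [D] equal to [8 * d * d.+1 ^ 2] and 2(d+1)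
    indices: matched or not, and a threshold from 0 to d. *)
Definition large_order (d : nat) : nat :=
  4 * (8 * d * d.+1 ^ 2) ^ 2 * (2 * d.+1 * d.+1 ^ 2).

(** Dropping the partner leaves a matched vertex d-1 neighbours, so its count is below [j] with
    probability about j/d instead of j/(d+1). This shift creates the margin. *)
Lemma exists_balanced_matching (G : sgraph) (d : nat) (p : G -> G) :
  0 < d -> regular G d -> involutive p -> (forall v, p v != v -> adj v (p v)) ->
  large_order d <= #|G| ->
  exists m (x : {ffun G -> 'I_m}), forall j, j <= d ->
    let c v := cnt ([set u | adj v u] :\ p v) v x in
    let e : rat := (#|G|%:R / (8 * (d%:R + 1)))%R in
    (`|d%:R * (d%:R + 1) * #|[set v | (p v == v) && (c v < j)%N]|%:R
      - d%:R * #|[set v | p v == v]|%:R * j%:R| <= e)%R /\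
    (`|d%:R * (d%:R + 1) * #|[set v | (p v != v) && (c v < j)%N]|%:R
      - (d%:R + 1) * #|[set v | p v != v]|%:R * j%:R| <= e)%R.
Proof.
move=> d0 Gd pK pA Gn; pose S v := [set u | adj v u] :\ p v.
have cS v : #|S v| = d - (p v != v).
  have := cardsD1 (p v) [set u | adj v u]; rewrite -[#|_|]/(deg v) Gd inE => ->.
  rewrite -/(S v); have [pv|/pA ->] := eqVneq (p v) v; last by rewrite addKn.
  by rewrite pv adj_irrefl subn0.
pose B (i : bool * 'I_d.+1) := [set v | (p v != v) == i.1].
(* Chosen so that the error n/D, scaled by d(d+1), becomes n/(8(d+1)). *)
pose D := 8 * d * d.+1 ^ 2.
have D0 : 0 < D by rewrite !muln_gt0 d0.
have [v|v|[b j] v|//||m [x Hx]] := @exists_balanced G d D S _ B (fun i => i.2).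
- by rewrite Gd.
- exact: subsetDl.
- by rewrite cS /= => _; have := ltn_ord j; case: (p v != v) => /=; lia.
- by rewrite card_prod card_bool card_ord.
exists m, x => j jd c e.
have Dd : (d%:R * (d%:R + 1) * (#|G|%:R / D%:R) = e :> rat)%R.
  rewrite /e /D !natrM -[d.+1]addn1 natrD; field.
  by rewrite -(natrD _ d 1) !pnatr_eq0 -!lt0n d0 addn1.
have dP0 : (0 < d%:R * (d%:R + 1) :> rat)%R by rewrite -(natrD _ d 1) -natrM ltr0n; lia.
have key b (q : nat) : (forall v, (p v != v) = b -> #|S v|.+1 = q) -> 0 < q ->
  (`|d%:R * (d%:R + 1) * #|[set v | ((p v != v) == b) && (c v < j)%N]|%:R
    - d%:R * (d%:R + 1) / q%:R * #|[set v | (p v != v) == b]|%:R * j%:R| <= e)%R.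
  move=> bq q0; have := Hx (b, Ordinal (jd : j < d.+1)); rewrite /B /=.
  rewrite (eq_bigr (fun=> j%:R / q%:R)%R) => [|v]; last by rewrite inE => /eqP/bq->.
  rewrite sumr_const -Dd -(ler_pM2l dP0) -{1}(gtr0_norm dP0) -normrM.
  rewrite (_ : #|[set v in _ | _]| = #|[set v | ((p v != v) == b) && (c v < j)]|).
    by congr (`| _ | <= _)%R; rewrite -mulr_natr; field; rewrite pnatr_eq0 -lt0n.
  by apply: eq_card => v; rewrite !inE.
have dn0 : (d%:R != 0 :> rat)%R by rewrite pnatr_eq0 -lt0n.
have dn1 : (d%:R + 1 != 0 :> rat)%R by rewrite -(natrD _ d 1) pnatr_eq0 addn1.
split.
- have := key false d.+1; rewrite -natr1 mulfK //.
  rewrite (_ : [set v | (p v != v) == false] = [set v | p v == v]); last first.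
    by apply/setP=> v; rewrite !inE eqbF_neg negbK.
  rewrite (_ : [set v | ((p v != v) == false) && _] = [set v | (p v == v) && (c v < j)]).
    by apply=> // v pv; rewrite cS pv subn0.
  by apply/setP=> v; rewrite !inE eqbF_neg negbK.
- have := key true d; rewrite [(_ * _ / d%:R)%R]mulrAC divff // mul1r.
  rewrite (_ : [set v | (p v != v) == true] = [set v | p v != v]); last first.
    by apply/setP=> v; rewrite !inE eqb_id.
  rewrite (_ : [set v | ((p v != v) == true) && _] = [set v | (p v != v) && (c v < j)]).
    by apply=> // v pv; rewrite cS pv subn1 prednK.
  by apply/setP=> v; rewrite !inE eqb_id.
Qed.

Lemma has_irregular_labeling_regular (G : sgraph) (d : nat) :
  2 <= d -> regular G d -> large_order d <= #|G| ->
  has_irregular_labeling G ((#|G| + d.-1) %/ d.+1).+1.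
Proof.
move=> d2 Gd Gn; have d0 : 0 < d by lia.
have n8 : 8 * d.+1 ^ 3 <= #|G|.
  by apply: leq_trans Gn; rewrite /large_order; nia.
set n := #|G| in Gn n8 *; set s := (n + d.-1) %/ d.+1.
have s1 : n <= d.+1 * s + 1.
  by have := ltn_ceil (n + d.-1) (ltn0Sn d); rewrite -/s; nia.
have s2 : d.+1 * s <= n + d.-1 by rewrite mulnC leq_trunc_div.
have s3 : 2 <= s by rewrite /s leq_divRL //; nia.
clearbody s; pose h := s./2.
have [h0 hs hl hu] : [/\ 0 < h, h < s, 2 * h <= s & s <= 2 * h + 1] by split; rewrite /h; lia.
(* The 2q matched vertices then number between 4N - 2 and 4N, where N = n/(8(d+1)). *)
pose q := n %/ (4 * d.+1).
have q1 : q * (4 * d.+1) <= n by exact: leq_trunc_div.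
have q2 : n < q.+1 * (4 * d.+1) by apply: ltn_ceil; rewrite muln_gt0.
clearbody q h.
have [|p [pK pA pc]] := @exists_matching G d q Gd d0.
  by apply: leq_trans q1; rewrite leq_mul2l leq_mul2r orbT.
have [m [x Hx]] := exists_balanced_matching d0 Gd pK pA Gn.
pose c v := cnt ([set u | adj v u] :\ p v) v x.
pose A j := #|[set v | (p v == v) && (c v < j)]|.
pose B j := #|[set v | (p v != v) && (c v < j)]|.
(* The sums at a vertex are s j if it is unmatched and s j + h if it is matched, for a count [j]. In
   order, these are the lower bounds of the band at s(j+1) and s j + h and the upper bounds at s j
   and s j + h. *)
have AB j : j < d -> [/\ s * (j + 1) <= A j.+1 + B j.+1, s * j + h <= A j.+1 + B j,
    A j.+1 + B j <= s * (j + 1) + 1 & A j.+1 + B j.+1 <= s * (j + 1) + h + 1].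
  move=> jd; have [A1 B1] := Hx j (ltnW jd); have [A2 B2] := Hx j.+1 jd.
  pose N : rat := (n%:R / (8 * (d%:R + 1)))%R.
  have nE : (8 * (d%:R + 1) * N = n%:R :> rat)%R.
    by rewrite /N; field; rewrite -(natrD _ d 1) pnatr_eq0 addn1.
  pose T : rat := (#|[set v | p v != v]|%:R)%R.
  have UE : (#|[set v | p v == v]|%:R = n%:R - T :> rat)%R.
    rewrite /T -natrB; last by rewrite max_card.
    congr (_%:R)%R; rewrite /n -(cardsC [set v | p v != v]) addKn.
    by apply: eq_card => v; rewrite !inE negbK.
  rewrite UE in A1 A2; rewrite -[j.+1]addn1 natrD in A2 B2.
  have P0 : (0 < 8 * (d%:R + 1) :> rat)%R by rewrite -(natrD _ d 1) -natrM ltr0n addn1.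
  have [] := @balanced_bounds d%:R s%:R h%:R N T j%:R
    (A j)%:R (B j)%:R (A j.+1)%:R (B j.+1)%:R; rewrite ?nE.
  - by rewrite ler_nat.
  - rewrite /N ler_pdivlMr // -(natrD _ d 1) -natrX -!natrM ler_nat; lia.
  - rewrite /T pc -(ler_pM2l P0) mulrBr mulrCA nE -(natrD _ d 1) -!natrM.
    by rewrite lerBlDr -natrD ler_nat; nia.
  - rewrite /T pc -(ler_pM2l P0) mulrCA nE -(natrD _ d 1) -!natrM ler_nat; nia.
  - by rewrite lerBlDr natr1 -natrM natr1 ler_nat; lia.
  - by rewrite lerBrDr natr1 -natrM natr1 -natrD ler_nat; lia.
  - by rewrite lerBlDr -natrM natr1 ler_nat; lia.
  - by rewrite -natrM ler_nat.
  - by [].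
  - by rewrite natr1 ler_nat.
  - exact: A1.
  - exact: B1.
  - by move: A2; rewrite addn1.
  - by move: B2; rewrite addn1.
  by rewrite !natr1 -!natrM -!natrD !natr1 !ler_nat; split; lia.
pose g u v := if p u == v then h else if m <= x v + x u then s else 0.
have gC u v : g u v = g v u.
  by rewrite /g addnC -(inj_eq (inv_inj pK)) pK eq_sym.
have gs u v : g u v <= s by rewrite /g; case: ifP => _; [exact: ltnW | case: ifP].
have sigE v : \sum_(u | adj v u) g v u = s * c v + h * (p v != v).
  rewrite (bigID (fun u => u == p v)) /= addnC; congr (_ + _).
    rewrite /c /cnt -sum1_card big_distrr /= [RHS]big_mkcond [LHS]big_mkcond.
    apply: eq_bigr => u _; rewrite !inE /g (eq_sym (p v)).
    by case: (adj v u); case: (u == p v) => //=; case: (m <= _); rewrite ?muln1.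
  have [pv|pv] := eqVneq (p v) v; rewrite ?muln0 ?muln1.
    by rewrite big1 // => u /andP[vu /eqP E]; rewrite E pv adj_irrefl in vu.
  rewrite (big_pred1 (p v)) ?/g ?eqxx // => u /=.
  by have [->|] := eqVneq u (p v); rewrite ?andbF // pA.
have cd v : c v <= d - (p v != v).
  have := cardsD1 (p v) [set u | adj v u]; rewrite -[#|_|]/(deg v) Gd inE.
  have : c v <= #|[set u | adj v u] :\ p v|.
    by apply/subset_leq_card/subsetP=> u; rewrite inE => /andP[].
  by case: (boolP (p v != v)) => [/pA->|_]; lia.
have cE j (P : pred G) : (forall v, P v = (c v < j)) -> #|[set v | P v]| = A j + B j.
  move=> PE; rewrite -(cardsID [set v | p v == v]).
  by congr (_ + _); apply: eq_card => v; rewrite !inE PE // andbC.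
(* Since 0 < h < s, the sums s j and s j + h interleave: a cut between them keeps unmatched vertices
   of count at most [j] and matched ones of count below [j]. *)
have cE' j (P : pred G) : (forall v, P v = (c v < if p v == v then j.+1 else j)) ->
    #|[set v | P v]| = A j.+1 + B j.
  move=> PE; rewrite -(cardsID [set v | p v == v]).
  by congr (_ + _); apply: eq_card => v; rewrite !inE PE;
    case: (p v == v); rewrite ?andbT ?andbF.
apply: (irregular_of_counts gC gs sigE _ _ Gd) => v.
- have [pv|pv] := eqVneq (p v) v; rewrite ?muln0 ?muln1 ?addn0.
    rewrite (cE (c v)) => [|u]; last by case: (p u != u); nia.
    case: (c v) (cd v) => [|j]; first by rewrite muln0.
    by rewrite pv eqxx /= => jd; have [] := AB j ltac:(lia); lia.
  have := cd v; rewrite pv => /= jd; have [_ + _ _] := AB (c v) ltac:(lia).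
  rewrite (cE' (c v)) // => u; case: eqP => _ /=; nia.
- have [pv|pv] := eqVneq (p v) v; rewrite ?muln0 ?muln1 ?addn0.
    have [jd|jd] := ltnP (c v) d.
      rewrite (cE' (c v)) => [|u]; last by case: eqP => _ /=; nia.
      by have [_ _ + _] := AB (c v) jd; lia.
    (* Count [d] lies beyond the range of [AB]; there the upper bound is just n <= (d+1)s + 1. *)
    apply: leq_trans (max_card _) _; rewrite -/n.
    have := cd v; rewrite pv eqxx /= => jd'; have -> : c v = d by lia.
    lia.
  have := cd v; rewrite pv => /= jd; have [_ _ _] := AB (c v) ltac:(lia).
  rewrite (cE (c v).+1) => [|u]; last by case: (p u != u); nia.
  lia.
Qed.

Theorem theorem4p2 (d : nat) (d_ge2 : (2 <= d)%N) :
  exists n1 : nat, forall G : sgraph,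
    regular G d -> (n1 <= #|G|)%N ->
    (tvs G)%:Z%R = Num.ceil ((#|G| + d)%N%:R / (d + 1)%N%:R : rat)%R.
Proof.
exists (large_order d) => G Gd Gn.
have n0 : 0 < #|G|.
  by apply: leq_trans Gn; rewrite /large_order; nia.
have hk := has_irregular_labeling_regular d_ge2 Gd Gn.
have d0 : (0 < (d + 1)%:R :> rat)%R by rewrite ltr0n addn1.
rewrite /tvs; case: ex_minnP => k /andP[k0 kl] kmin.
have klo := order_le_of_irregular Gd kl n0.
have kup : k <= ((#|G| + d.-1) %/ d.+1).+1 by apply: kmin; rewrite hk.
(* The strict bound on k - 1 comes from the construction ([kup]), the other from counting weights
   ([klo]). *)
apply/esym/ceil_def; rewrite ltr_pdivlMr // ler_pdivrMr //; apply/andP; split.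
  rewrite intrB mulrBl mul1r ltrBlDr -natrM -natrD ltr_nat.
  have := leq_trunc_div (#|G| + d.-1) d.+1; nia.
by rewrite -natrM ler_nat; lia.
Qed.
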